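(* There exists an algorithm that receives as input a primitive labeled graph $\mathcal{G}=(G,L)$ and computes the covering radius $R(X_{\mathcal{G}})$ of the sofic shift $X_{\mathcal{G}}$ in finite time.
   Context: A graph $G=(\mathcal{V}_G,\mathcal{E}_G)$ means a finite directed graph with vertex set $\mathcal{V}_G$ and edge set $\mathcal{E}_G$; each edge $e$ has a source $s(e)$ and a target $t(e)$ in $\mathcal{V}_G$; parallel edges and self-loops are allowed. A walk of length $n\ge 1$ is a tuple $(e_1,\dots,e_n)\in\mathcal{E}_G^n$ with $t(e_k)=s(e_{k+1})$ for $1\le k<n$. $G$ is irreducible if any two vertices are connected by a walk. A cycle is a walk with $s(e_1)=t(e_n)$ (no injectivity required). An irreducible graph is primitive if the greatest common divisor of all its cycle lengths is $1$. A labeled graph is a pair $\mathcal{G}=(G,L)$ with $G$ a graph and $L:\mathcal{E}_G\to\Sigma$ a function to a finite alphabet $\Sigma$; it is primitive if $G$ is. Let $\mathcal{C}_n(\mathcal{G})\subseteq\Sigma^n$ be the set of words $(L(e_1),\dots,L(e_n))$ over all walks $(e_1,\dots,e_n)$ of length $n$ in $G$. Define $X_{\mathcal{G}}=\{x\in\Sigma^{\mathbb{Z}} : (x_m,\dots,x_n)\in\mathcal{C}_{n-m+1}(\mathcal{G})\ \text{for all } m\le n\}$. The Hamming distance $d_H(u,v)$ of $u,v\in\Sigma^n$ is the number of coordinates $i$ with $u_i\ne v_i$. The covering radius of a code $\mathcal{C}\subseteq\Sigma^n$ is $R(\mathcal{C})=\max_{v\in\Sigma^n}\min_{w\in\mathcal{C}}d_H(v,w)$.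 For a shift space $X\subseteq\Sigma^{\mathbb{Z}}$ (closed shift-invariant subset) let $\mathcal{C}_n(X)=\{(x_1,\dots,x_n):x\in X\}$. The covering radius of $X$ is $R(X)=\lim_{n\to\infty}\frac1n R(\mathcal{C}_n(X))$ when the limit exists; it is known that the limit exists for $X=X_{\mathcal{G}}$ for any labeled graph $\mathcal{G}$. *)

(* Defs.v *)
From mathcomp Require Import all_boot all_order all_algebra.
From mathcomp Require Import boolp classical_sets reals topology normedtype.
From mathcomp Require Import sequences.
Set Implicit Arguments.
Unset Strict Implicit.
Unset Printing Implicit Defensive.
Import Order.TTheory GRing.Theory Num.Theory.
Import numFieldNormedType.Exports.

Local Open Scope classical_set_scope.

Record graph := Graph {
  vertex : finType;
  edge : finType;
  src : edge -> vertex;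
  tgt : edge -> vertex }.

Record labeled_graph := LabeledGraph {
  lgraph :> graph;
  alphabet : finType;
  label : edge lgraph -> alphabet }.

Definition is_walk (G : graph) (p : seq (edge G)) : bool :=
  (0 < size p) && sorted (fun e e' => tgt e == src e') p.

Definition irreducible (G : graph) : Prop :=
  forall u v : vertex G, exists (e : edge G) (p : seq (edge G)),
    [/\ is_walk (e :: p), src e = u & tgt (last e p) = v].

Definition cycle_lengths (G : graph) : set nat :=
  [set l | exists (e : edge G) (p : seq (edge G)),
     [/\ is_walk (e :: p), src e = tgt (last e p) & l = size (e :: p)]].

Definition is_gcd (S : set nat) (g : nat) : Prop :=
  (forall l, S l -> g %| l) /\
  (forall d, (forall l, S l -> d %| l) -> d %| g).

(* The gcd of the empty set is 0, so a primitive graph has at least one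
   cycle, hence at least one vertex. *)
Definition primitive (G : graph) : Prop :=
  irreducible G /\ is_gcd (cycle_lengths G) 1.

Definition graph_code (G : labeled_graph) (n : nat) :
    {set n.-tuple (alphabet G)} :=
  [set map_tuple (@label G) p | p : n.-tuple (edge G) & is_walk p]%SET.

(* The word x_m x_{m+1} ... x_{m+n-1}. *)
Definition window (A : Type) (x : int -> A) (m : int) (n : nat) : n.-tuple A :=
  [tuple x (m + i%:Z)%R | i < n].

Definition sofic_shift (G : labeled_graph) : set (int -> alphabet G) :=
  [set x | forall m n : int, (m <= n)%R ->
     window x m (absz (n - m + 1)%R) \in graph_code G (absz (n - m + 1)%R)].
Arguments sofic_shift : clear implicits.

Definition hamming (A : finType) (n : nat) (u v : n.-tuple A) : nat :=
  #|[pred i | tnth u i != tnth v i]|.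

(* Distances between words of length n are at most n, so the default value n
   of the minimum is only visible when C is empty. *)
Definition code_covering_radius (A : finType) (n : nat)
    (C : {set n.-tuple A}) : nat :=
  \max_(v : n.-tuple A) \big[minn/n]_(w in C) hamming v w.

Definition shift_code (A : finType) (X : set (int -> A)) (n : nat) :
    {set n.-tuple A} :=
  [set w : n.-tuple A | `[< exists2 x, X x & window x 1%R n = w >] ]%SET.

(* "The limit defining the covering radius of X exists and is equal to r." *)
Definition is_covering_radius (R : realType) (A : finType)
    (X : set (int -> A)) (r : R) : Prop :=
  (fun n : nat => (code_covering_radius (shift_code X n))%:R / n%:R : R)%R
    @ \oo --> r.

(* Model of computation: mu-recursive (partial recursive) functions,
   indexed by their arity. *)
Inductive recfun : nat -> Type :=
| RZero n : recfun n
| RSucc : recfun 1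
| RProj n (i : 'I_n) : recfun n
| RComp n k (f : recfun k) (g : 'I_k -> recfun n) : recfun n
| RPrec n (f : recfun n) (g : recfun n.+2) : recfun n.+1
| RMu n (f : recfun n.+1) : recfun n.

(* [computes f x y]: f is defined at x, with value y.
   Primitive recursion is on the first argument:
     h (0, x) = f x   and   h (k + 1, x) = g (k, h (k, x), x).
   Minimization looks for the least y with f (y, x) = 0, all the earlier
   values f (i, x) being defined and nonzero. *)
Fixpoint computes (n : nat) (f : recfun n) : n.-tuple nat -> nat -> Prop :=
  match f in recfun n return n.-tuple nat -> nat -> Prop with
  | RZero _ => fun _ y => y = 0
  | RSucc => fun x y => y = (thead x).+1
  | RProj _ i => fun x y => y = tnth x i
  | RComp _ k f g => fun x y =>
      exists z : k.-tuple nat,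
        (forall i, computes (g i) x (tnth z i)) /\ computes f z y
  | RPrec _ f g => fun x =>
      (fix iter (k : nat) (y : nat) : Prop :=
         match k with
         | 0 => computes f [tuple of behead x] y
         | k'.+1 => exists2 z, iter k' z &
             computes g [tuple of k' :: z :: behead x] y
         end) (thead x)
  | RMu _ f => fun x y =>
      computes f [tuple of y :: x] 0 /\
      forall i, i < y -> exists z, computes f [tuple of i :: x] z.+1
  end.

Lemma computes_functional n (f : recfun n) x y y' :
  computes f x y -> computes f x y' -> y = y'.
Proof.
elim: f x y y' => {n} /=.
- by move=> n x y y' -> ->.
- by move=> x y y' -> ->.
- by move=> n i x y y' -> ->.
- move=> n k f IHf g IHg x y y' [z [gz fz]] [z' [gz' fz']].
  have eqz : z = z' by apply: eq_from_tnth => i; exact: IHg (gz i) (gz' i).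
  by apply: IHf fz _; rewrite eqz.
- move=> n f IHf g IHg x; elim: (thead x) => [|k IHk] y y'; first exact: IHf.
  move=> [z hz gz] [z' hz' gz'].
  by move: gz'; rewrite -(IHk _ _ hz hz'); apply: IHg gz.
- move=> n f IHf x y y' [fy lty] [fy' lty'].
  case: (ltngtP y y') => // [/lty'|/lty] [z fz].
    by have := IHf _ _ _ fy fz.
  by have := IHf _ _ _ fy' fz.
Qed.

(* The finite description of G handed to an algorithm: the sizes of the
   alphabet and of the vertex set, followed by the triples
   (source, target, label) of the edges; vertices and letters are given by
   their ranks in the enumerations of their types. *)
Definition description (G : labeled_graph) : seq nat :=
  #|alphabet G| :: #|vertex G| ::
  flatten [seq [:: enum_rank (src e) : nat; enum_rank (tgt e) : nat;
                   enum_rank (label e) : nat] | e <- enum (edge G)].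

(* The algorithm M halts on G and outputs the fraction p / q; finite
   sequences of natural numbers are coded by the bijection [CodeSeq.code]. *)
Definition outputs_fraction (M : recfun 1) (G : labeled_graph) (p q : nat) :
    Prop :=
  computes M [tuple CodeSeq.code (description G)] (CodeSeq.code [:: p; q]).

(* Main.v *)
(* Let cost v be the least number of mismatches between the word v and the
   label of a walk of length |v|. If any two vertices are joined by a walk of
   length exactly N, then for every v and every vertex y some walk ending at y
   has at most cost v + N mismatches with v. Hence the increments of cost are
   governed by a finite state, of at most K = 2^(|V|(N+1)) values: two words in
   the same state gain equally from every suffix. Cut the cycles out of long
   words: the maximal mean gain of a cycle is a/K! for some natural number a,
   and K! R(C_n) = a n + O(1) with an explicit error bound. So R(X_G) =
     a/K!, and a
   is obtained from R(C_n) for one explicit n by rounding. The algorithm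
   searches for N, computes R(C_n) by enumeration, and rounds. *)
Require Import Defs.
From mathcomp Require Import all_boot all_order all_algebra.
From mathcomp Require Import boolp classical_sets reals topology normedtype.
From mathcomp Require Import sequences.
From mathcomp Require Import zify lra.
Set Implicit Arguments.
Unset Strict Implicit.
Unset Printing Implicit Defensive.

(** * Computable functions *)

Definition env_tuple (n : nat) (e : nat -> nat) : n.-tuple nat :=
  [tuple e i | i < n].

(* A function of the variables e 0, ..., e (n - 1); binders shift the
   environment e, as with de Bruijn indices. *)
Definition computable (n : nat) (f : (nat -> nat) -> nat) : Prop :=
  exists M : recfun n, forall e, computes M (env_tuple n e) (f e).

Definition scons (i : nat) (e : nat -> nat) (k : nat) : nat :=
  if k is k'.+1 then e k' else i.

Lemma env_tuple_scons n i e :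
  env_tuple n.+1 (scons i e) = [tuple of i :: env_tuple n e].
Proof.
apply: eq_from_tnth => k; rewrite tnth_mktuple.
case: (unliftP ord0 k) => [j|] ->; last by [].
by rewrite tnthS tnth_mktuple.
Qed.

Lemma computable_var n k : k < n -> computable n (fun e => e k).
Proof.
by move=> ltkn; exists (RProj (Ordinal ltkn)) => e /=; rewrite tnth_mktuple.
Qed.

Lemma computable_comp m n f (g : nat -> (nat -> nat) -> nat) :
  computable m f -> (forall i, i < m -> computable n (g i)) ->
  computable n (fun e => f (fun i => g i e)).
Proof.
move=> [M HM] Hg.
have /fin_all_exists [N HN] (i : 'I_m) : exists N : recfun n,
  forall e, computes N (env_tuple n e) (g i e) by exact: Hg (ltn_ord i).
exists (RComp M N) => e /=; exists (env_tuple m (fun i => g i e)).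
by split=> // i; rewrite tnth_mktuple.
Qed.

Lemma computable_subst n (f g : (nat -> nat) -> nat) :
  computable n.+1 f -> computable n g ->
  computable n (fun e => f (scons (g e) e)).
Proof.
move=> Hf Hg.
apply: (@computable_comp _ _ _ (fun i e => scons (g e) e i) Hf) =>
  -[|i] //= lti.
exact: computable_var.
Qed.

Lemma computable_rename m n (h : nat -> nat) f :
  (forall i, i < m -> h i < n) -> computable m f ->
  computable n (fun e => f (fun i => e (h i))).
Proof.
move=> ltn Hf; apply: (@computable_comp _ _ _ (fun i e => e (h i)) Hf) => i lti.
by apply: computable_var; exact: ltn.
Qed.

Lemma computable_shift2 n f :
  computable n f -> computable n.+2 (fun e => f (fun i => e i.+2)).
Proof. exact: (@computable_rename _ _ (fun i => i.+2)). Qed.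

Lemma computable_shift1 n f :
  computable n f -> computable n.+1 (fun e => f (fun i => e i.+1)).
Proof. exact: (@computable_rename _ _ (fun i => i.+1)). Qed.

(** The body of a bounded sum, maximum or minimum sees the index and the parameters, but the step of
    a primitive recursion also has the accumulator at position 1; the renaming makes room for it. *)
Lemma computable_skip1 n (f : nat -> (nat -> nat) -> nat) :
  computable n.+1 (fun e => f (e 0) (fun i => e i.+1)) ->
  computable n.+2 (fun e => f (e 0) (fun i => e i.+2)).
Proof.
apply: (@computable_rename _ _ (fun i => if i is j.+1 then j.+2 else 0)).
by case.
Qed.

Lemma computable_succ n f : computable n f -> computable n (fun e => (f e).+1).
Proof.
move=> [M HM]; exists (RComp RSucc (fun=> M)) => e /=.
by exists [tuple f e]; split=> // i; rewrite (ord1 i) tnth0.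
Qed.

Lemma computable_const n c : computable n (fun=> c).
Proof.
elim: c => [|c IH]; first by exists (RZero n).
exact: computable_succ IH.
Qed.

Fixpoint natrec (b : nat) (s : nat -> nat -> nat) (k : nat) : nat :=
  if k is k'.+1 then s k' (natrec b s k') else b.

Lemma computes_prec n (B : recfun n) (S : recfun n.+2) (x : n.+1.-tuple nat) h :
  computes B [tuple of behead x] (h 0) ->
  (forall k, computes S [tuple of k :: h k :: behead x] (h k.+1)) ->
  computes (RPrec B S) x (h (thead x)).
Proof. by move=> HB HS /=; elim: (thead x) => [//|k IHk]; exists (h k). Qed.

Lemma computable_natrec n b (s : nat -> nat -> (nat -> nat) -> nat) k :
  computable n b ->
  computable n.+2 (fun e => s (e 0) (e 1) (fun i => e i.+2)) ->
  computable n k ->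
  computable n (fun e => natrec (b e) (fun i z => s i z e) (k e)).
Proof.
move=> [B HB] [S HS] Hk.
(* [RPrec] recurses on its first argument, so the bound is first made variable 0; [k] is substituted
   for it at the end. *)
pose r e := natrec (b e) (fun i z => s i z e).
have H : computable n.+1 (fun e => r (fun i => e i.+1) (e 0)).
  exists (RPrec B S) => e.
  set e' := fun i => e i.+1.
  have behead_env : behead (env_tuple n.+1 e) = env_tuple n e'.
    rewrite (_ : e = scons (e 0) e') ?env_tuple_scons //.
    by apply/funext => -[].
  rewrite -[e 0](_ : thead (env_tuple n.+1 e) = e 0); last exact: tnth_mktuple.
  apply: (@computes_prec _ _ _ _ (r e')) => [|i].
    by rewrite (_ : [tuple of _] = env_tuple n e'); [exact: HB|exact: val_inj].
  rewrite (_ : [tuple of _] = env_tuple n.+2 (scons i (scons (r e' i) e'))).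
    exact: HS.
  by rewrite !env_tuple_scons; apply: val_inj; rewrite /= behead_env.
exact: (computable_subst H Hk).
Qed.

Lemma computable_ext n f g : f =1 g -> computable n f -> computable n g.
Proof. by move=> /funext ->. Qed.

Lemma computable_add n f g : computable n f -> computable n g ->
  computable n (fun e => f e + g e).
Proof.
move=> Hf Hg.
apply: (@computable_ext _ (fun e => natrec (f e) (fun _ z => z.+1) (g e))).
  by move=> e; elim: (g e) => [|k /= ->]; rewrite ?addn0 ?addnS.
apply: computable_natrec => //; apply: computable_succ; exact: computable_var.
Qed.

Lemma computable_mul n f g : computable n f -> computable n g ->
  computable n (fun e => f e * g e).
Proof.
move=> Hf Hg.
apply: (@computable_ext _ (fun e => natrec 0 (fun _ z => z + f e) (g e))).
  by move=> e; elim: (g e) => [|k /= ->]; rewrite ?muln0 // mulnS addnC.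
apply: computable_natrec => //; first exact: computable_const.
by apply: computable_add; [exact: computable_var | exact: computable_shift2].
Qed.

Lemma computable_exp n f g : computable n f -> computable n g ->
  computable n (fun e => f e ^ g e).
Proof.
move=> Hf Hg.
apply: (@computable_ext _ (fun e => natrec 1 (fun _ z => z * f e) (g e))).
  by move=> e; elim: (g e) => [|k /= ->]; rewrite ?expn0 // expnSr.
apply: computable_natrec => //; first exact: computable_const.
by apply: computable_mul; [exact: computable_var | exact: computable_shift2].
Qed.

Lemma computable_factorial n f : computable n f ->
  computable n (fun e => (f e)`!).
Proof.
move=> Hf.
apply: (@computable_ext _ (fun e => natrec 1 (fun k z => k.+1 * z) (f e))).
  by move=> e; elim: (f e) => [|k /= ->]; rewrite ?factS.
apply: computable_natrec => //; first exact: computable_const.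
by apply: computable_mul; [apply: computable_succ|]; exact: computable_var.
Qed.

Lemma computable_sub n f g : computable n f -> computable n g ->
  computable n (fun e => f e - g e).
Proof.
move=> Hf Hg.
(* The inner recursion is the predecessor function; subtraction iterates it. *)
apply: (@computable_ext _
  (fun e => natrec (f e) (fun _ z => natrec 0 (fun i _ => i) z) (g e))).
  move=> e; elim: (g e) => [|k /= ->]; rewrite ?subn0 // subnS.
  by case: (f e - k).
apply: computable_natrec => //.
by apply: computable_natrec; [exact: computable_const|..];
  exact: computable_var.
Qed.

Definition ifz (T : Type) (b : nat) (x y : T) : T := if b == 0 then x else y.

Lemma computable_ifz n b f g :
  computable n b -> computable n f -> computable n g ->
  computable n (fun e => ifz (b e) (f e) (g e)).
Proof.
move=> Hb Hf Hg.
apply: (@computable_ext _ (fun e => natrec (f e) (fun _ _ => g e) (b e))).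
  by move=> e; rewrite /ifz; case: (b e).
by apply: computable_natrec => //; exact: computable_shift2.
Qed.

Lemma computable_eq0 n f : computable n f ->
  computable n (fun e => nat_of_bool (f e == 0)).
Proof.
move=> Hf; apply: (@computable_ext _ (fun e => ifz (f e) 1 0)).
  by move=> e; rewrite /ifz; case: (f e == 0).
by apply: computable_ifz => //; exact: computable_const.
Qed.

Lemma computable_leq n f g : computable n f -> computable n g ->
  computable n (fun e => nat_of_bool (f e <= g e)).
Proof. by move=> Hf Hg; apply: computable_eq0; exact: computable_sub. Qed.

Lemma computable_eq n f g : computable n f -> computable n g ->
  computable n (fun e => nat_of_bool (f e == g e)).
Proof.
move=> Hf Hg.
apply: (@computable_ext _ (fun e =>
  nat_of_bool ((f e - g e) + (g e - f e) == 0))).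
  by move=> e; rewrite addn_eq0 !subn_eq0 -eqn_leq.
by apply: computable_eq0; apply: computable_add; exact: computable_sub.
Qed.

Lemma computable_neq n f g : computable n f -> computable n g ->
  computable n (fun e => nat_of_bool (f e != g e)).
Proof.
move=> Hf Hg.
apply: (@computable_ext _ (fun e =>
  nat_of_bool (nat_of_bool (f e == g e) == 0))).
  by move=> e; case: (f e == g e).
by apply: computable_eq0; exact: computable_eq.
Qed.

Lemma computable_sum n k (f : nat -> (nat -> nat) -> nat) :
  computable n k -> computable n.+1 (fun e => f (e 0) (fun i => e i.+1)) ->
  computable n (fun e => \sum_(0 <= i < k e) f i e).
Proof.
move=> Hk Hf.
apply: (@computable_ext _ (fun e => natrec 0 (fun i z => z + f i e) (k e))).
  move=> e; elim: (k e) => [|j /= ->]; first by rewrite big_nil.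
  by rewrite big_nat_recr.
apply: computable_natrec => //; first exact: computable_const.
apply: computable_add; first exact: computable_var.
exact: computable_skip1.
Qed.

Definition maxf (k : nat) (f : nat -> nat) : nat :=
  natrec 0 (fun i z => maxn z (f i)) k.

Definition minf (d k : nat) (f : nat -> nat) : nat :=
  natrec d (fun i z => minn z (f i)) k.

Lemma leq_maxf k f i : i < k -> f i <= maxf k f.
Proof.
rewrite /maxf; elim: k => // k IHk; rewrite ltnS leq_eqVlt /= leq_max.
by case/orP => [/eqP -> | /IHk ->]; rewrite ?leqnn ?orbT.
Qed.

Lemma maxf_leP k f b : (forall i, i < k -> f i <= b) -> maxf k f <= b.
Proof.
rewrite /maxf; elim: k => //= k IHk Hf; rewrite geq_max Hf // IHk // => i lti.
by rewrite Hf // ltnS ltnW.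
Qed.

Lemma minf_leq d k f i : i < k -> minf d k f <= f i.
Proof.
rewrite /minf; elim: k => // k IHk; rewrite ltnS leq_eqVlt /= geq_min.
by case/orP => [/eqP -> | /IHk ->]; rewrite ?leqnn ?orbT.
Qed.

Lemma minf_geP d k f b :
  b <= d -> (forall i, i < k -> b <= f i) -> b <= minf d k f.
Proof.
move=> lebd; rewrite /minf; elim: k => //= k IHk Hf.
by rewrite leq_min Hf // IHk // => i lti; rewrite Hf // ltnS ltnW.
Qed.

Lemma computable_maxf n k (f : nat -> (nat -> nat) -> nat) :
  computable n k -> computable n.+1 (fun e => f (e 0) (fun i => e i.+1)) ->
  computable n (fun e => maxf (k e) (fun i => f i e)).
Proof.
move=> Hk Hf; apply: (computable_natrec (s := fun i z e => maxn z (f i e))) =>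
  //.
  exact: computable_const.
apply: (@computable_ext _ (fun e => e 1 + (f (e 0) (fun i => e i.+2) - e 1))).
  by move=> e; rewrite maxnE.
apply: computable_add; first exact: computable_var.
by apply: computable_sub; [exact: computable_skip1 | exact: computable_var].
Qed.

Lemma computable_minf n d k (f : nat -> (nat -> nat) -> nat) :
  computable n d ->
  computable n k -> computable n.+1 (fun e => f (e 0) (fun i => e i.+1)) ->
  computable n (fun e => minf (d e) (k e) (fun i => f i e)).
Proof.
move=> Hd Hk Hf; apply: (computable_natrec (s := fun i z e =>
  minn z (f i e))) => //.
apply: (@computable_ext _ (fun e => e 1 - (e 1 - f (e 0) (fun i => e i.+2)))).
  by move=> e; rewrite minnE.
apply: computable_sub; first exact: computable_var.
by apply: computable_sub; [exact: computable_var | exact: computable_skip1].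
Qed.

(** Lets a program obtain a number q by counting: if membership of i turns out to mean i < q and the
    search bound m is at least q, the count is q. Quotients, heads and lengths of lists are found
    this way. *)
Lemma sum_ltn_min m q : \sum_(0 <= i < m) (i < q) = minn m q.
Proof.
elim: m => [|m IHm]; first by rewrite big_nil min0n.
rewrite big_nat_recr //= IHm; case: (ltnP m q) => [ltmq|leqm].
  by rewrite !minnE; move: ltmq; rewrite -subn_gt0; lia.
by rewrite addn0; move: leqm; lia.
Qed.

Lemma computable_div n f g : computable n f -> computable n g ->
  computable n (fun e => f e %/ g e).
Proof.
move=> Hf Hg.
apply: (@computable_ext _
  (fun e => ifz (g e) 0 (\sum_(0 <= i < f e) (i.+1 * g e <= f e)))).
  move=> e; rewrite /ifz; case: eqP => [->|/eqP]; first by rewrite divn0.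
  rewrite -lt0n => gt0; under eq_bigr do rewrite -leq_divRL //.
  by rewrite sum_ltn_min; apply/minn_idPr/leq_div.
apply: computable_ifz => //; first exact: computable_const.
apply: (computable_sum (f := fun i e => nat_of_bool (i.+1 * g e <= f e))) => //.
apply: computable_leq; last exact: computable_shift1.
by apply: computable_mul; [apply: computable_succ; exact: computable_var
  | exact: computable_shift1].
Qed.

Lemma computable_mod n f g : computable n f -> computable n g ->
  computable n (fun e => f e %% g e).
Proof.
move=> Hf Hg; apply: (@computable_ext _ (fun e => f e - f e %/ g e * g e)).
  by move=> e; rewrite {1}(divn_eq (f e) (g e)) addKn.
by apply: computable_sub => //; apply: computable_mul => //;
  exact: computable_div.
Qed.

(** Totality of [F] makes the earlier values defined, and the choice of the least zero makes them
    nonzero, as [RMu] demands. *)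
Lemma computes_mu n (F : recfun n.+1) (x : n.-tuple nat) (f : nat -> nat) :
  (forall y, computes F [tuple of y :: x] (f y)) -> (exists y, f y = 0) ->
  exists y, f y = 0 /\ computes (RMu F) x y.
Proof.
move=> HF ex0.
have ex0b : exists y, f y == 0 by have [y /eqP] := ex0; exists y.
case: (ex_minnP ex0b) => y /eqP fy0 miny; exists y; split=> //=.
split; first by rewrite -fy0; exact: HF.
move=> i ltiy; exists (f i).-1; rewrite prednK; first exact: HF.
by rewrite lt0n; apply: contraL ltiy => fi0; rewrite -leqNgt miny.
Qed.

(** With its variants below, reduces an operation applied to arbitrary terms to the same operation
    applied to variables, so that each piece of the program is verified once in a small context. *)
Lemma computable_app1 n g f :
  computable 1 (fun e => g (e 0)) -> computable n f ->
  computable n (fun e => g (f e)).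
Proof.
move=> Hg Hf; apply: (@computable_comp _ _ _ (nth (fun=> 0) [:: f]) Hg).
by case.
Qed.

Lemma computable_app2 n g f1 f2 :
  computable 2 (fun e => g (e 0) (e 1)) ->
  computable n f1 -> computable n f2 ->
  computable n (fun e => g (f1 e) (f2 e)).
Proof.
move=> Hg H1 H2; apply: (@computable_comp _ _ _ (nth (fun=> 0) [:: f1; f2]) Hg).
by case=> [|[]].
Qed.

Lemma computable_app3 n g f1 f2 f3 :
  computable 3 (fun e => g (e 0) (e 1) (e 2)) ->
  computable n f1 -> computable n f2 -> computable n f3 ->
  computable n (fun e => g (f1 e) (f2 e) (f3 e)).
Proof.
move=> Hg H1 H2 H3.
apply: (@computable_comp _ _ _ (nth (fun=> 0) [:: f1; f2; f3]) Hg).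
by case=> [|[|[]]].
Qed.

Lemma computable_app4 n g f1 f2 f3 f4 :
  computable 4 (fun e => g (e 0) (e 1) (e 2) (e 3)) ->
  computable n f1 -> computable n f2 -> computable n f3 -> computable n f4 ->
  computable n (fun e => g (f1 e) (f2 e) (f3 e) (f4 e)).
Proof.
move=> Hg H1 H2 H3 H4.
apply: (@computable_comp _ _ _ (nth (fun=> 0) [:: f1; f2; f3; f4]) Hg).
by case=> [|[|[|[]]]].
Qed.

Ltac computability1 :=
  first
    [ exact: computable_const
    | by apply: computable_var
    | assumption
    | apply: computable_succ | apply: computable_add | apply: computable_mul
    | apply: computable_exp | apply: computable_sub | apply: computable_div
    | apply: computable_mod | apply: computable_factorial
    | apply: computable_leq | apply: computable_eq | apply: computable_neq
    | apply: computable_ifz | apply: computable_sum | apply: computable_maxf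
    | apply: computable_minf | apply: computable_natrec ].

Ltac computability := repeat computability1.

(** * The program *)

(* A name ending in "c" denotes an operation on codes: a list s is given by
   [CodeSeq.code s], and a word or a walk of length n by a number below b ^ n
   whose base-b digits are the ranks of its letters or edges. *)
Definition headc (c : nat) : nat := \sum_(0 <= i < c) (c %% 2 ^ i.+1 == 0).

Definition tailc (c : nat) : nat := c %/ 2 ^ headc c %/ 2.

Definition dropc (c i : nat) : nat := natrec c (fun _ => tailc) i.

Definition nthc (c i : nat) : nat := headc (dropc c i).

(** Only the empty list has code 0, and a code is at least the length of its list; so the nonempty
    suffixes all start at some i < c, and their number is the length. *)
Definition sizec (c : nat) : nat := \sum_(0 <= i < c) (dropc c i != 0).

Lemma computable_headc n f : computable n f ->
  computable n (fun e => headc (f e)).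
Proof. by apply: computable_app1; rewrite /headc; computability. Qed.

Lemma computable_tailc n f : computable n f ->
  computable n (fun e => tailc (f e)).
Proof.
apply: computable_app1; rewrite /tailc.
by computability; apply: computable_headc; computability.
Qed.

Lemma computable_nthc n f g : computable n f -> computable n g ->
  computable n (fun e => nthc (f e) (g e)).
Proof.
apply: computable_app2; apply: computable_headc; rewrite /dropc.
by computability; apply: computable_tailc; computability.
Qed.

Lemma computable_sizec n f : computable n f ->
  computable n (fun e => sizec (f e)).
Proof.
apply: computable_app1; rewrite /sizec /dropc.
by computability; apply: computable_tailc; computability.
Qed.

(** The code of [x :: s] is 2^x (2 m + 1), with m the code of [s]. So [headc] is the 2-adic
    valuation: 2^(i+1) divides the code exactly when i < x. *)
Lemma headc_cons x s : headc (CodeSeq.code (x :: s)) = x.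
Proof.
rewrite /headc /=; set m := CodeSeq.code s.
have ltx : x < 2 ^ x * m.*2.+1.
  by apply: leq_trans (ltn_expl x (isT : 1 < 2)) _; rewrite leq_pmulr.
rewrite (eq_bigr (fun i => nat_of_bool (i < x))) => [|i _].
  by rewrite sum_ltn_min; apply/minn_idPr/ltnW.
congr nat_of_bool; rewrite -/(_ %| _); apply/idP/idP => [|ltix]; last first.
  by apply: dvdn_mulr; exact: dvdn_exp2l.
rewrite Gauss_dvdl; last by rewrite coprimeXl // coprime2n /= odd_double.
by rewrite dvdn_Pexp2l.
Qed.

Lemma tailc_code s : tailc (CodeSeq.code s) = CodeSeq.code (behead s).
Proof.
case: s => [|x s]; first by rewrite /tailc !div0n.
by rewrite /tailc headc_cons /= mulKn ?expn_gt0 // -addn1 -muln2 divnMDl //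
  addn0.
Qed.

Lemma dropc_code s i : dropc (CodeSeq.code s) i = CodeSeq.code (drop i s).
Proof.
rewrite /dropc; elim: i => [|i /= ->]; first by rewrite drop0.
by rewrite tailc_code -drop1 drop_drop add1n.
Qed.

Lemma nthc_code s i : nthc (CodeSeq.code s) i = nth 0 s i.
Proof.
rewrite /nthc dropc_code; case: (ltnP i (size s)) => [lti|lei].
  by rewrite (drop_nth 0 lti) headc_cons.
by rewrite drop_oversize // nth_default // /headc big_nil.
Qed.

Lemma size_leq_code s : size s <= CodeSeq.code s.
Proof.
elim: s => //= x s IHs; apply: leq_trans (leq_pmull _ _);
  last by rewrite expn_gt0.
by rewrite ltnS (leq_trans IHs) // -addnn leq_addr.
Qed.

Lemma sizec_code s : sizec (CodeSeq.code s) = size s.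
Proof.
rewrite /sizec (eq_bigr (fun i => nat_of_bool (i < size s))) => [|i _].
  by rewrite sum_ltn_min; apply/minn_idPr/size_leq_code.
congr nat_of_bool; rewrite dropc_code; case: (ltnP i (size s)) => [lti|lei].
  by rewrite (drop_nth 0 lti) /= muln_eq0 expn_eq0.
by rewrite drop_oversize.
Qed.

(** A description consists of two sizes and then three numbers per edge, whence this formula and the
    offsets 2, 3 and 4 below. *)
Definition edgesc (c : nat) : nat := (sizec c - 2) %/ 3.

Definition srcc (c j : nat) : nat := nthc c (3 * j).+2.
Definition tgtc (c j : nat) : nat := nthc c (3 * j).+3.
Definition labelc (c j : nat) : nat := nthc c (3 * j).+4.

Definition digit (b x i : nat) : nat := (x %/ b ^ i) %% b.

Definition edgec (c p i : nat) : nat := digit (edgesc c) p i.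

Definition breaksc (c n p : nat) : nat :=
  \sum_(0 <= i < n - 1) (tgtc c (edgec c p i) != srcc c (edgec c p i.+1)).

Definition mismatchesc (c n p v : nat) : nat :=
  \sum_(0 <= i < n) (labelc c (edgec c p i) != digit (nthc c 0) v i).

(** All edge sequences are enumerated; one that is not a walk counts n mismatches, which cannot
    lower a minimum already capped at n. *)
Definition radiusc (c n : nat) : nat :=
  maxf (nthc c 0 ^ n) (fun v =>
    minf n (edgesc c ^ n) (fun p =>
      ifz (breaksc c n p) (mismatchesc c n p v) n)).

(* The default value 1 of [minf] makes this the number of pairs of vertices that
   are not joined by a walk of length n (for n > 0). *)
Definition unlinkedc (c n : nat) : nat :=
  \sum_(0 <= u < nthc c 1) \sum_(0 <= w < nthc c 1)
    minf 1 (edgesc c ^ n) (fun p =>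
      breaksc c n p + (srcc c (edgec c p 0) != u) + (tgtc c (edgec c p (n - 1))
        != w)).

(* The bound K on the number of states when walks of length n join any two
   vertices; [slackc] is the error bound B in a n <= K! (R(C_n) + B). *)
Definition statesc (c n : nat) : nat := 2 ^ (nthc c 1 * n.+1).

Definition slackc (c n : nat) : nat := statesc c n + statesc c n ^ 2.

(** Write B for the slack and r for the radius at length K! M. The growth bounds for this length,
    divided by K!, read a M <= r + B and r <= a M + K. Since M > K + B, the quotient of r + B by M
    is exactly a. *)
Definition numerc (c n : nat) : nat :=
  let K := statesc c n in
  let M := K + slackc c n + 1 in
  (radiusc c (K`! * M) + slackc c n) %/ M.

(** This is [CodeSeq.code] of the two-element list of numerator and denominator K!, written out. *)
Definition outc (c n : nat) : nat :=
  2 ^ numerc c n * (2 * (2 ^ (statesc c n)`!)).+1.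

Lemma computable_edgesc n f : computable n f ->
  computable n (fun e => edgesc (f e)).
Proof.
apply: computable_app1; rewrite /edgesc.
by computability; apply: computable_sizec; computability.
Qed.

Lemma computable_srcc n f g : computable n f -> computable n g ->
  computable n (fun e => srcc (f e) (g e)).
Proof.
apply: computable_app2; rewrite /srcc.
by apply: computable_nthc; computability.
Qed.

Lemma computable_tgtc n f g : computable n f -> computable n g ->
  computable n (fun e => tgtc (f e) (g e)).
Proof.
apply: computable_app2; rewrite /tgtc.
by apply: computable_nthc; computability.
Qed.

Lemma computable_labelc n f g : computable n f -> computable n g ->
  computable n (fun e => labelc (f e) (g e)).
Proof.
apply: computable_app2; rewrite /labelc.
by apply: computable_nthc; computability.
Qed.

Lemma computable_digit n b f g :
  computable n b -> computable n f -> computable n g ->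
  computable n (fun e => digit (b e) (f e) (g e)).
Proof. by apply: computable_app3; rewrite /digit; computability. Qed.

Lemma computable_edgec n c f g :
  computable n c -> computable n f -> computable n g ->
  computable n (fun e => edgec (c e) (f e) (g e)).
Proof.
apply: computable_app3; rewrite /edgec; apply: computable_digit; last first.
- by computability.
- by computability.
by apply: computable_edgesc; computability.
Qed.

Ltac computabilityc1 :=
  first
    [ apply: computable_nthc | apply: computable_edgesc | apply: computable_srcc
    | apply: computable_tgtc | apply: computable_labelc | apply:
      computable_digit
    | apply: computable_edgec | computability1 ].

Ltac computabilityc := repeat computabilityc1.

Lemma computable_breaksc n c k p :
  computable n c -> computable n k -> computable n p ->
  computable n (fun e => breaksc (c e) (k e) (p e)).
Proof. by apply: computable_app3; rewrite /breaksc; computabilityc. Qed.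

Lemma computable_mismatchesc n c k p v :
  computable n c -> computable n k -> computable n p -> computable n v ->
  computable n (fun e => mismatchesc (c e) (k e) (p e) (v e)).
Proof. by apply: computable_app4; rewrite /mismatchesc; computabilityc. Qed.

Lemma computable_radiusc n c k : computable n c -> computable n k ->
  computable n (fun e => radiusc (c e) (k e)).
Proof.
apply: computable_app2; rewrite /radiusc.
by repeat first
  [apply: computable_breaksc | apply: computable_mismatchesc | computabilityc1].
Qed.

Lemma computable_unlinkedc n c k : computable n c -> computable n k ->
  computable n (fun e => unlinkedc (c e) (k e)).
Proof.
apply: computable_app2; rewrite /unlinkedc.
by repeat first [apply: computable_breaksc | computabilityc1].
Qed.

Lemma computable_outc n c k : computable n c -> computable n k ->
  computable n (fun e => outc (c e) (k e)).
Proof.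
apply: computable_app2; rewrite /outc /numerc /slackc /statesc.
by repeat first [apply: computable_radiusc | computabilityc1].
Qed.

(** Everything except the search for a connecting length is total, so the program halts as soon as
    such a length exists. The search runs over n with length n + 1, because [unlinkedc] is
    meaningful for positive lengths only. *)
Lemma covering_radius_program : exists M : recfun 1, forall c,
  (exists n, unlinkedc c n.+1 = 0) ->
  exists n, unlinkedc c n.+1 = 0 /\ computes M [tuple c] (outc c n.+1).
Proof.
have [F HF] : computable 2 (fun e => unlinkedc (e 1) (e 0).+1).
  by apply: computable_unlinkedc; computability.
have [O HO] : computable 2 (fun e => outc (e 1) (e 0).+1).
  by apply: computable_outc; computability.
have env2 c y : env_tuple 2 (nth 0 [:: y; c]) = [tuple y; c].
  by apply: eq_from_tnth => i; rewrite tnth_mktuple (tnth_nth 0).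
(* [O] receives the result of the search and the input itself. *)
exists (RComp O (fun i : 'I_2 => if i == ord0 then RMu F else RProj ord0)).
move=> c ex0.
have [y|n [n0 Mn]] := @computes_mu _ F [tuple c] (fun n =>
  unlinkedc c n.+1) _ ex0.
  have := HF (nth 0 [:: y; c]); rewrite env2 /=.
  by rewrite (_ : [tuple y; c] = [tuple of y :: [tuple c]]) //; exact: val_inj.
exists n; split=> //=; exists [tuple n; c]; split.
  by case=> [[|[|//]] ?].
by have := HO (nth 0 [:: n; c]); rewrite env2.
Qed.

(** * Growth of costs with finitely many states *)

Section FiniteStateGrowth.

Variables (A : Type) (T : finType) (m : seq A -> nat) (S : seq A -> T) (a0 : A).
Hypothesis m_le_size : forall v, m v <= size v.
Hypothesis m_cat : forall v u, m v <= m (v ++ u).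
(** The gain of a suffix depends only on the state before it; the additive form avoids truncated
    subtraction. *)
Hypothesis m_state : forall v v' u, S v = S v' ->
  m (v ++ u) + m v' = m (v' ++ u) + m v.

Let K := #|T|.

(** The length bound makes [size b] divide K! and bounds the gain, so scores are integers in a
    bounded range. *)
Definition loop (a b : seq A) : Prop :=
  [/\ S a = S (a ++ b), 0 < size b & size (a ++ b) <= K].

(* [K`!] times the mean gain of m along the loop b: an integer. *)
Definition score (a b : seq A) : nat := (m (a ++ b) - m a) * (K`! %/ size b).

(** Pigeonhole: the prefixes of lengths 0 to K are K + 1 words with at most K states. *)
Lemma long_word_loop v : K <= size v ->
  exists a b c, loop a b /\ v = a ++ b ++ c.
Proof.
move=> leKv; pose f (i : 'I_K.+1) := S (take i v).
have : ~~ injectiveb f.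
  by apply/negP => /injectiveP /leq_card; rewrite card_ord ltnn.
case/injectivePn => i [j neq_ij eq_f].
wlog ltij : i j neq_ij eq_f / i < j.
  move=> IH; case: (ltngtP i j) => [ltij|ltji|/val_inj eqij].
  - exact: (IH i j).
  - by apply: (IH j i) => //; rewrite eq_sym.
  - by rewrite eqij eqxx in neq_ij.
have lejv : j <= size v by apply: leq_trans leKv; rewrite -ltnS.
have cat_ij : take i v ++ drop i (take j v) = take j v.
  by rewrite -[in RHS](cat_take_drop i (take j v)) take_takel // ltnW.
exists (take i v), (drop i (take j v)), (drop j v); split; last first.
  by rewrite catA cat_ij cat_take_drop.
split; rewrite ?cat_ij //.
  by rewrite size_drop size_takel // subn_gt0.
by rewrite size_takel // -ltnS.
Qed.

Lemma loop_size a b : loop a b -> size b <= K.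
Proof. by case=> _ _; apply: leq_trans; rewrite size_cat leq_addl. Qed.

Lemma dvdn_loop_fact a b : loop a b -> size b %| K`!.
Proof.
by move=> lab; apply: dvdn_fact; rewrite (loop_size lab) andbT; case: lab.
Qed.

Lemma loop_gain a b : loop a b -> m (a ++ b) - m a <= K.
Proof.
by case=> _ _ leK; rewrite (leq_trans (leq_subr _ _)) // (leq_trans (m_le_size
  _)).
Qed.

(** As [a] and [a ++ b] share a state, the other copies of [b] gain the same after either, so each
    copy adds the gain of the first. *)
Lemma loop_iter a b k : loop a b ->
  m (a ++ flatten (nseq k b)) = m a + k * (m (a ++ b) - m a).
Proof.
case=> eqS _ _; elim: k => [|k IHk] /=; first by rewrite cats0 addn0.
have := m_state (flatten (nseq k b)) eqS; rewrite -catA IHk.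
by have := m_cat a b; rewrite mulSn; lia.
Qed.

Lemma best_loop : exists a b, loop a b /\
  forall a' b', loop a' b' -> score a' b' <= score a b.
Proof.
pose P s := `[< exists a b, loop a b /\ score a b = s >].
have exP : exists s, P s.
  have [|a [b [_ [lab _]]]] := @long_word_loop (nseq K a0).
    by rewrite size_nseq.
  by exists (score a b); apply/asboolP; exists a, b.
have ubP s : P s -> s <= K * K`!.
  move=> /asboolP [a [b [lab <-]]]; apply: leq_mul; first exact: loop_gain.
  exact: leq_div.
case: (ex_maxnP exP ubP) => s /asboolP [a [b [lab <-]]] maxs.
exists a, b; split=> // a' b' lab'; apply: maxs; apply/asboolP.
by exists a', b'.
Qed.

(** The number p is the best score. Above: cut loops out of v one by one; each cut loses at most p /
    K! per letter, and fewer than K letters remain. Below: repeat the best loop and truncate to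
    length n. *)
Lemma finite_state_growth : exists p,
  (forall v, K`! * m v <= p * size v + K`! * K) /\
  (forall n, exists2 v, size v = n & p * n <= K`! * (m v + (K + K ^ 2))).
Proof.
have [a [b [lab maxab]]] := best_loop.
exists (score a b); split=> [v|n].
  have [k] := ubnP (size v); elim: k v => // k IHk v ltvk.
  case: (ltnP (size v) K) => [ltvK|leKv].
    by apply: leq_trans (leq_addl _ _); rewrite leq_pmul2l ?fact_gt0 //
      (leq_trans (m_le_size v)) // ltnW.
  have [a' [b' [c [lab' eqv]]]] := long_word_loop leKv.
  have [eqS b'gt0 _] := lab'.
  have IH : K`! * m (a' ++ c) <= score a b * size (a' ++ c) + K`! * K.
    by apply: IHk; move: ltvk; rewrite eqv !size_cat; lia.
  have gain : K`! * (m (a' ++ b') - m a') <= score a b * size b'.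
    rewrite mulnC -[X in _ * X](divnK (dvdn_loop_fact lab')) mulnA.
    by rewrite leq_pmul2r // maxab.
  (* The suffix [c] gains the same with or without [b'] before it, so removing [b'] lowers m by
     exactly the gain of the loop. *)
  have := m_state c eqS; rewrite -catA -eqv => eqm.
  have {}eqm : m v = m (a' ++ c) + (m (a' ++ b') - m a').
    by have := m_cat a' b'; lia.
  by rewrite eqm eqv !size_cat mulnDr; move: IH gain; rewrite size_cat; lia.
have [_ bgt0 leabK] := lab.
have leaK : size a <= K by rewrite (leq_trans _ leabK) // size_cat leq_addr.
have score_le : score a b <= K * K`!.
  by apply: leq_mul; [exact: loop_gain | exact: leq_div].
set w := m (a ++ b) - m a.
have scoreE : score a b * size b = w * K`!.
  by rewrite /score -mulnA divnK // (dvdn_loop_fact lab).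
(* As [b] is nonempty, n copies are enough to fill n letters. *)
pose v := take n (a ++ flatten (nseq n b)).
have sizev : size v = n.
  rewrite size_takel // size_cat size_flatten /shape map_nseq sumn_nseq.
  by rewrite (leq_trans _ (leq_addl _ _)) // leq_pmull.
exists v => //; case: (ltnP n (size a)) => [ltna|lean].
  apply: (@leq_trans (K * K`! * K)).
    by apply: leq_mul => //; rewrite (leq_trans (ltnW ltna)).
  by rewrite mulnAC mulnC leq_mul // -mulnn; lia.
(* The number of complete copies of [b] inside [v]. *)
pose k := (n - size a) %/ size b.
have lekn : k <= n by rewrite (leq_trans (leq_div _ _)) // leq_subr.
have mv : k * w <= m v.
  apply: (@leq_trans (m (a ++ flatten (nseq k b)))).
    by rewrite loop_iter // leq_addl.
  have -> : v = (a ++ flatten (nseq k b)) ++ drop (size a + k * size b) v.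
    rewrite -{1}(cat_take_drop (size a + k * size b) v); congr (_ ++ _).
    have sz : size (a ++ flatten (nseq k b)) = size a + k * size b.
      by rewrite size_cat size_flatten /shape map_nseq sumn_nseq mulnC.
    rewrite take_takel; last first.
      by have := leq_trunc_div (n - size a) (size b); rewrite -/k; lia.
    by rewrite -sz -(subnKC lekn) nseqD flatten_cat catA take_size_cat.
  exact: m_cat.
have lt_n : n <= k.+1 * size b + size a.
  by have := ltn_ceil (n - size a) bgt0; rewrite -/k; lia.
(* Origin of the slack K + K^2: the incomplete last copy of [b] accounts for one gain, at most K,
   and the initial [a] for at most K! K^2 after scaling by K!. *)
have leq1 : score a b * n <= score a b * (k.+1 * size b + size a).
  by rewrite leq_mul2l lt_n orbT.
have leq2 : score a b * size a <= K * K`! * K by apply: leq_mul.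
apply: leq_trans leq1 _; rewrite mulnDr [k.+1 * _]mulnC mulnA scoreE.
have leq3 : w * K`! * k.+1 <= K`! * (m v + K).
  rewrite [w * _]mulnC -mulnA leq_pmul2l ?fact_gt0 // mulnS addnC leq_add //.
    by rewrite mulnC.
  exact: loop_gain.
apply: leq_trans (leq_add leq3 leq2) _.
by rewrite -mulnn !mulnDr; lia.
Qed.

End FiniteStateGrowth.

(** * Walks in primitive graphs *)

Section Walks.

Variable G : graph.
Implicit Types (x y : vertex G) (p q : seq (edge G)).

(** Unlike [is_walk], this admits the empty walk and names the starting vertex, so that walks can be
    cut and concatenated freely. *)
Fixpoint walk_from x p : bool :=
  if p is e :: p' then (src e == x) && walk_from (tgt e) p' else true.

Definition walk_end x p : vertex G := last x (map (@tgt G) p).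

Lemma walk_from_cat x p q :
  walk_from x (p ++ q) = walk_from x p && walk_from (walk_end x p) q.
Proof. by elim: p x => //= e p IHp x; rewrite IHp andbA. Qed.

Lemma walk_end_cat x p q : walk_end x (p ++ q) = walk_end (walk_end x p) q.
Proof. by rewrite /walk_end map_cat last_cat. Qed.

Lemma is_walk_cons e p : is_walk (e :: p) = walk_from (src e) (e :: p).
Proof.
rewrite /is_walk /= eqxx /=; elim: p e => //= e' p IHp e.
by rewrite IHp eq_sym.
Qed.

Lemma is_walkP p : reflect (0 < size p /\ exists x, walk_from x p) (is_walk p).
Proof.
case: p => [|e p]; first by right; case.
rewrite is_walk_cons; apply: (iffP idP) => [H|[_ [x]]]; first by split;
  last exists (src e).
by rewrite /= eqxx => /andP [].
Qed.

Lemma walk_end_cons x e p : walk_end x (e :: p) = tgt (last e p).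
Proof. by rewrite /walk_end /= last_map. Qed.

Definition connects n : Prop := forall x y, exists p,
  [/\ walk_from x p, size p = n & walk_end x p = y].

Lemma irreducible_walk x y : irreducible G ->
  exists p, [/\ walk_from x p, walk_end x p = y & 0 < size p].
Proof.
move=> irrG; have [e [p [walkp srce tgte]]] := irrG x y.
by exists (e :: p); rewrite -srce -is_walk_cons walk_end_cons.
Qed.

Lemma walk_to n y : (forall y, exists e : edge G, tgt e = y) ->
  exists x p, [/\ walk_from x p, size p = n & walk_end x p = y].
Proof.
move=> in_edge; elim: n y => [|n IHn] y; first by exists y, [::].
have [e tgte] := in_edge y; have [x [p [walkp sizep endp]]] := IHn (src e).
exists x, (p ++ [:: e]).
by rewrite walk_from_cat walk_end_cat walkp endp size_cat sizep addn1 /= eqxx.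
Qed.

End Walks.

(** Let d be the least positive difference of two members t and t + d. A member not divisible by d
    would yield a smaller difference, so d divides all members and d = 1. All large numbers are then
    combinations of t and t + 1. *)
Lemma semigroup_eventually (L : nat -> Prop) :
  L 0 -> (forall i j, L i -> L j -> L (i + j)) ->
  (forall d, (forall l, L l -> d %| l) -> d %| 1) ->
  exists n0, forall n, n0 <= n -> L n.
Proof.
move=> L0 LD gcdL.
have LM i k : L i -> L (k * i).
  by move=> Li; elim: k => // k IHk; rewrite mulSn; exact: LD.
pose P d := `[< 0 < d /\ exists t, L t /\ L (t + d) >].
have exP : exists d, P d.
  case: (pselect (exists l, L l /\ 0 < l)) => [[l [Ll lgt0]]|nex].
    by exists l; apply/asboolP; split=> //; exists 0.
  suff : 0 %| 1 by [].
  apply: gcdL => l Ll; rewrite dvd0n; case: (posnP l) => // lgt0.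
  by case: nex; exists l.
case: (ex_minnP exP) => d /asboolP [dgt0 [t [Lt Ltd]]] mind.
have /eqP d1 : d == 1.
  rewrite -dvdn1; apply: gcdL => l Ll; rewrite /dvdn; apply: contraT => rneq0.
  have /mind : P (l %% d).
    apply/asboolP; split; first by rewrite lt0n.
    (* Adding the remainder of l to this member gives (l / d) t + l, with the integer quotient l /
       d, again a member. *)
    exists (l %/ d * (t + d)); split; first exact: LM.
    rewrite mulnDr -addnA -divn_eq.
    by apply: LD => //; exact: LM.
  by rewrite leqNgt ltn_pmod.
(* From t^2 on, the quotient of n by t is at least the remainder, so that many copies of t can be
   turned into t + 1. *)
exists (t * t) => n len; rewrite {}d1 in Ltd.
case: (posnP t) => [t0|tgt0].
  by rewrite t0 add0n in Ltd; rewrite -(muln1 n); exact: LM.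
have le_r : n %% t <= n %/ t.
  apply: leq_trans (ltnW (ltn_pmod n tgt0)) _.
  by rewrite leq_divRL.
rewrite (_ : n = (n %/ t - n %% t) * t + n %% t * (t + 1)); last first.
  rewrite {1}(divn_eq n t) mulnBl mulnDr muln1 addnA subnK //.
  by rewrite leq_mul2r le_r orbT.
by apply: LD; exact: LM.
Qed.

(** The lengths of closed walks at x form a semigroup. If d divides them all, it divides every cycle
    length l: a closed walk from x through the cycle can be taken with or without the cycle, and the
    lengths differ by l. A fixed walk from x to y then follows the closed walk, and a maximum over
    the pairs (x, y) makes the length uniform. *)
Lemma primitive_connects G : primitive G ->
  exists n, connects G n.+1.
Proof.
move=> [irrG [_ gcdG]].
have loops (x : vertex G) : exists n0, forall n, n0 <= n -> exists p,
    [/\ walk_from x p, size p = n & walk_end x p = x].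
  apply: semigroup_eventually; first by exists [::].
    move=> i j [p [wp <- ep]] [q [wq <- eq]]; exists (p ++ q).
    by rewrite walk_from_cat walk_end_cat wp ep wq eq size_cat.
  move=> d dvdd; apply: gcdG => l [e [p [walkp eqe ->]]].
  have [a [wa ea _]] := irreducible_walk x (src e) irrG.
  have [b [wb eb _]] := irreducible_walk (src e) x irrG.
  have dvd_ab : d %| size a + size b.
    by apply: dvdd; exists (a ++ b);
      rewrite walk_from_cat walk_end_cat wa ea wb eb size_cat.
  rewrite -(dvdn_addr _ dvd_ab); apply: dvdd; exists (a ++ (e :: p) ++ b).
  rewrite !walk_from_cat !walk_end_cat wa ea walk_end_cons -eqe -is_walk_cons
    walkp wb eb.
  by rewrite !size_cat; split=> //; lia.
have big (xy : vertex G * vertex G) : exists n0, forall n, n0 <= n -> exists p,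
    [/\ walk_from xy.1 p, size p = n & walk_end xy.1 p = xy.2].
  case: xy => x y /=; have [n0 Hn0] := loops x.
  have [a [wa ea _]] := irreducible_walk x y irrG.
  exists (n0 + size a) => n len; have [|p [wp sp ep]] := Hn0 (n - size a).
    by lia.
  exists (p ++ a); rewrite walk_from_cat walk_end_cat wp ep wa ea size_cat sp.
  by split=> //; lia.
have [f Hf] := fin_all_exists big.
exists (\max_xy f xy) => x y; apply: (Hf (x, y)).
by apply: leqW; exact: (leq_bigmax (F := f)).
Qed.

(** * Minima with a default value *)

Lemma bigminn_geP (I : Type) (r : seq I) (P : pred I) F d b :
  b <= d -> (forall i, P i -> b <= F i) -> b <= \big[minn/d]_(i <- r | P i) F i.
Proof.
move=> lebd leF; apply: (big_ind (fun m => b <= m)) => // x y bx by_.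
by rewrite leq_min bx.
Qed.

Lemma bigminn_leq (I : finType) (P : pred I) F d i :
  P i -> \big[minn/d]_(j | P j) F j <= F i.
Proof.
rewrite -big_filter => Pi; have : i \in [seq j <- index_enum I | P j].
  by rewrite mem_filter Pi mem_index_enum.
elim: [seq j <- _ | _] => // j s IHs; rewrite in_cons big_cons geq_min.
by case/predU1P => [->|/IHs ->]; rewrite ?leqnn ?orbT.
Qed.

Lemma bigminn_leq_default (I : Type) (r : seq I) (P : pred I) F d :
  \big[minn/d]_(i <- r | P i) F i <= d.
Proof.
elim: r => [|i r IHr]; first by rewrite big_nil.
by rewrite big_cons; case: ifP => // _; rewrite geq_min IHr orbT.
Qed.

Lemma bigminn_attained (I : finType) (P : pred I) F d :
  let b := \big[minn/d]_(i | P i) F i in b = d \/ exists2 i, P i & F i = b.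
Proof.
apply: (big_ind (fun m => m = d \/ exists2 i, P i & F i = m));
  [by left| move=> x y Hx Hy|by move=> i Pi; right; exists i].
by case: leqP.
Qed.

(** * The cost of a word *)

Section Cost.

Variable G : labeled_graph.
Implicit Types (x y : vertex G) (p q : seq (edge G)) (u v : seq (alphabet G)).

Definition mismatches p v : nat :=
  count (fun ea => label ea.1 != ea.2) (zip p v).

Lemma mismatches_cat p q v u : size p = size v ->
  mismatches (p ++ q) (v ++ u) = mismatches p v + mismatches q u.
Proof. by move=> eqsz; rewrite /mismatches zip_cat // count_cat. Qed.

Lemma mismatches_leq p v : mismatches p v <= size v.
Proof. by rewrite (leq_trans (count_size _ _)) // size_zip geq_minr. Qed.

(** The default [size v] bounds every number of mismatches, so it never undercuts a walk. *)
Definition cost v : nat :=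
  \big[minn/size v]_(p : (size v).-tuple (edge G) | [exists x, walk_from x p])
    mismatches p v.

Lemma cost_leq x p v : walk_from x p -> size p = size v ->
  cost v <= mismatches p v.
Proof.
move=> walkp /eqP eqsz.
apply: (@bigminn_leq _ _ (fun p : (size v).-tuple _ =>
  mismatches p v) _ (Tuple eqsz)).
by apply/existsP; exists x.
Qed.

Lemma cost_leq_size v : cost v <= size v.
Proof. exact: bigminn_leq_default. Qed.

Section Connected.

Variables (N : nat) (x0 : vertex G).
Hypothesis linkN : connects G N.+1.

Lemma in_edge y : exists e : edge G, tgt e = y.
Proof.
have [[|e p] [_ //= _ <-]] := linkN y y.
by exists (last e p); rewrite walk_end_cons.
Qed.

(** If the minimum is the default value, then every walk of the right length attains it, and one is
    built backwards along incoming edges. *)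
Lemma cost_attained v : exists x p,
  [/\ walk_from x p, size p = size v & mismatches p v = cost v].
Proof.
have [costE|[p /existsP [x walkp] costp]] := bigminn_attained
  (fun p : (size v).-tuple (edge G) => [exists x, walk_from x p])
  (fun p : (size v).-tuple (edge G) => mismatches p v) (size v).
  have [x [p [walkp sizep _]]] := walk_to (size v) x0 in_edge.
  exists x, p; split=> //; apply/eqP; rewrite eqn_leq (cost_leq walkp) // andbT.
  by rewrite [cost v]costE mismatches_leq.
by exists x, p; rewrite size_tuple.
Qed.

Definition reachable v y k : Prop := exists x p,
  [/\ walk_from x p, size p = size v, walk_end x p = y & mismatches p v <= k].

(* Only the excesses i <= N.+1 matter: by [reachable_spread], a walk with a
   larger excess can be replaced by one of excess at most N.+1. *)
Definition cost_state v : {ffun vertex G -> {set 'I_N.+2}} :=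
  [ffun y => [set i : 'I_N.+2 | `[< reachable v y (cost v + i) >]]].

Lemma cost_cat v u : cost v <= cost (v ++ u).
Proof.
have [x [p [walkp sizep <-]]] := cost_attained (v ++ u).
have lev : size v <= size p by rewrite sizep size_cat leq_addr.
rewrite -(cat_take_drop (size v) p) mismatches_cat ?size_takel //.
apply: leq_trans (leq_addr _ _); apply: (@cost_leq x);
  last by rewrite size_takel.
by move: walkp; rewrite -{1}(cat_take_drop (size v) p) walk_from_cat =>
  /andP [].
Qed.

(** Replace the last N + 1 edges of an optimal walk by a link to y, which adds at most N + 1
    mismatches; for a shorter word any walk ending at y will do. *)
Lemma reachable_spread v y : reachable v y (cost v + N.+1).
Proof.
case: (leqP N.+1 (size v)) => [leN|ltN]; last first.
  have [x [p [walkp sizep endp]]] := walk_to (size v) y in_edge.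
  exists x, p; split=> //; apply: leq_trans (mismatches_leq _ _) _.
  by rewrite (leq_trans (ltnW ltN)) // leq_addl.
have [x [p [walkp sizep costp]]] := cost_attained v.
set k := size v - N.+1.
have sizek : size (take k p) = k by rewrite size_takel // sizep leq_subr.
have sizevk : size (take k v) = k by rewrite size_takel // leq_subr.
have [c [walkc sizec endc]] := linkN (walk_end x (take k p)) y.
exists x, (take k p ++ c); split.
- rewrite walk_from_cat walkc andbT.
  by move: walkp; rewrite -{1}(cat_take_drop k p) walk_from_cat => /andP [].
- by rewrite size_cat sizek sizec subnK.
- by rewrite walk_end_cat.
rewrite -[v in mismatches _ v](cat_take_drop k v) mismatches_cat ?sizek ?sizevk
  //.
apply: leq_add.
  rewrite -costp -{2}(cat_take_drop k p) -{2}(cat_take_drop k v).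
  by rewrite mismatches_cat ?sizek ?sizevk // leq_addr.
by apply: leq_trans (mismatches_leq _ _) _; rewrite size_drop subKn.
Qed.

(** Cut an optimal walk for [v ++ u] where [v] ends. Equality of states supplies a walk for [v']
    with the same end and no larger excess over the cost; the second half is kept. *)
Lemma cost_state_leq v v' u : cost_state v = cost_state v' ->
  cost (v' ++ u) + cost v <= cost (v ++ u) + cost v'.
Proof.
move=> eqS; have [x [p [walkp sizep costp]]] := cost_attained (v ++ u).
have lev : size v <= size p by rewrite sizep size_cat leq_addr.
set p1 := take (size v) p; set p2 := drop (size v) p.
have eqp : p = p1 ++ p2 by rewrite cat_take_drop.
have size1 : size p1 = size v by rewrite size_takel.
have size2 : size p2 = size u by rewrite size_drop sizep size_cat addKn.
move: walkp; rewrite eqp walk_from_cat => /andP [walk1 walk2].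
set y := walk_end x p1 in walk2.
have cost12 : cost (v ++ u) = mismatches p1 v + mismatches p2 u.
  by rewrite -costp eqp mismatches_cat.
have cost1 : cost v <= mismatches p1 v by exact: cost_leq walk1 size1.
(* An excess above N + 1 does not fit in the state; the excess N + 1 is then available by
   [reachable_spread]. *)
have [i lei reach_i] : exists2 i : 'I_N.+2, cost v + i <= mismatches p1 v &
    reachable v y (cost v + i).
  case: (ltnP (mismatches p1 v - cost v) N.+2) => [lti|gei].
    exists (Ordinal lti); rewrite /= subnKC //.
    by exists x, p1.
  exists ord_max; last exact: reachable_spread.
  by rewrite /=; lia.
have : i \in cost_state v' y by rewrite -eqS ffunE inE; apply/asboolP.
rewrite ffunE inE => /asboolP [x' [p' [walk' size' end' cost']]].
have : cost (v' ++ u) <= mismatches (p' ++ p2) (v' ++ u).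
  apply: (@cost_leq x'); first by rewrite walk_from_cat walk' end'.
  by rewrite !size_cat size' size2.
by rewrite mismatches_cat // cost12; lia.
Qed.

Lemma card_cost_state :
  #|{ffun vertex G -> {set 'I_N.+2}}| = 2 ^ (#|vertex G| * N.+2).
Proof.
rewrite card_ffun -cardsT -powersetT card_powerset cardsT card_ord -expnM.
by rewrite mulnC.
Qed.

Lemma cost_growth : let K := 2 ^ (#|vertex G| * N.+2) in
  exists a : nat,
  (forall v, K`! * cost v <= a * size v + K`! * K) /\
  (forall n, exists2 v, size v = n & a * n <= K`! * (cost v + (K + K ^ 2))).
Proof.
have [e _] := in_edge x0.
have := @finite_state_growth _ _ cost cost_state (label e).
rewrite card_cost_state; apply.
- exact: cost_leq_size.
- exact: cost_cat.
- move=> v v' u eqS; apply/eqP; rewrite eqn_leq.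
  by apply/andP; split; apply: cost_state_leq.
Qed.

End Connected.
End Cost.

(** * Correctness of the program *)

Section Codes.

Variable G : labeled_graph.
Local Notation follows := (fun e e' : edge G => tgt e == src e').

Lemma mismatches_sum e0 a0 n (p : seq (edge G)) v : size p = n -> size v = n ->
  mismatches p v = \sum_(0 <= i < n) (label (nth e0 p i) != nth a0 v i).
Proof.
move=> sizep sizev; rewrite /mismatches -sum1_count big_mkcond /=.
rewrite (big_nth (e0, a0)) size_zip sizep sizev minnn.
by apply: eq_bigr => i _; rewrite nth_zip ?sizep //=; case: eqP.
Qed.

Lemma hamming_mismatches n (v : n.-tuple (alphabet G)) (p : n.-tuple (edge G)) :
  hamming v (map_tuple (@label G) p) = mismatches p v.
Proof.
case: n v p => [|n] v p.
  by rewrite (tuple0 p) (tuple0 v) /hamming eq_card0 // => -[].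
rewrite (@mismatches_sum (thead p) (thead v) n.+1) ?size_tuple //.
rewrite /hamming -sum1_card big_mkcond big_mkord /=.
apply: eq_bigr => i _; rewrite inE tnth_map eq_sym.
by rewrite -!tnth_nth; case: eqP.
Qed.

(** By irreducibility a walk closes up to a cycle; the labels of its periodic repetition form a
    point of the shift that shows the given word. *)
Lemma sofic_shift_code n : irreducible G ->
  shift_code (sofic_shift G) n.+1 = graph_code G n.+1.
Proof.
move=> irrG; apply/setP => w; rewrite inE; apply/asboolP/idP => [[x Xx <-]|].
  have := Xx 1%R (Posz n.+1) isT.
  by rewrite (_ : (Posz n.+1 - 1 + 1)%R = Posz n.+1) // GRing.subrK.
case/imsetP => p; rewrite inE => walkp ->{w}.
set e := thead p.
have [q [walkq endq _]] := irreducible_walk (walk_end (src e) p) (src e) irrG.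
pose c := p ++ q; pose L := size c.
have walkc : walk_from (src e) c.
  rewrite walk_from_cat walkq andbT.
  by move: walkp; rewrite {1 2}(tuple_eta p) is_walk_cons.
have endc : walk_end (src e) c = src e by rewrite walk_end_cat.
have eqc : c = e :: behead c by rewrite /c {1 2}(tuple_eta p).
have Lgt0 : 0 < L by rewrite /L eqc.
(* Windows start at coordinate 1, so that coordinate must read edge 0 of the cycle. *)
pose r (k : int) := absz (modz (k - 1) (Posz L)).
have rE k : Posz (r k) = modz (k - 1) (Posz L).
  by rewrite /r gez0_abs // modz_ge0 // -lt0n.
have ltr k : r k < L by rewrite -ltz_nat rE ltz_pmod.
have rS k : r (k + 1)%R = (r k).+1 %% L.
  apply/eqP; rewrite -eqz_nat rE -modz_nat -addn1 PoszD rE GRing.addrK.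
  by rewrite modzDml GRing.subrK.
pose f k := nth e c (r k).
have f_follows k : follows (f k) (f (k + 1)%R).
  rewrite /f rS; case: (ltnP (r k).+1 L) => [ltS|leS].
    have /(sortedP e) : sorted follows c.
      by move: walkc; rewrite eqc -is_walk_cons => /andP [].
    by rewrite modn_small //; apply.
  have rL : (r k).+1 = L by apply/eqP; rewrite eqn_leq leS ltr.
  rewrite rL modnn (_ : r k = (size c).-1); last by rewrite -/L -rL.
  rewrite nth_last.
  move: endc; rewrite eqc walk_end_cons /= => ->; exact: eqxx.
exists (fun k => label (f k)).
  move=> m n' lemn'; set l := absz _.
  apply/imsetP; exists [tuple f (m + Posz i)%R | i < l].
    rewrite inE /is_walk size_tuple; apply/andP; split.
      by rewrite absz_gt0; lia.
    apply/(sortedP e) => i; rewrite size_tuple => ltS.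
    have := tnth_nth e [tuple f (m + Posz i)%R | i < l] (Ordinal ltS).
    have := tnth_nth e [tuple f (m + Posz i)%R | i < l] (Ordinal (ltnW ltS)).
    rewrite !tnth_mktuple /= => <- <-.
    by have := f_follows (m + Posz i)%R; rewrite -GRing.addrA -PoszD addn1.
  by apply: eq_from_tnth => i;
    rewrite !(tnth_map, tnth_mktuple) ?tnth_ord_tuple.
apply: eq_from_tnth => i; rewrite tnth_mktuple tnth_map (tnth_nth e);
  congr label.
have ri : r (1 + Posz i)%R = i.
  apply/eqP; rewrite -eqz_nat rE GRing.addrC GRing.addKr modz_nat modn_small //.
  by rewrite /L size_cat size_tuple ltn_addr.
by rewrite /f ri /c nth_cat size_tuple ltn_ord.
Qed.

Lemma sofic_covering_radius n (x0 : vertex G) N : irreducible G ->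
  connects G N.+1 ->
  code_covering_radius (shift_code (sofic_shift G) n.+1) =
  \max_(v : n.+1.-tuple (alphabet G)) cost v.
Proof.
move=> irrG linkN; rewrite sofic_shift_code //; apply: eq_bigr => v _.
apply/eqP; rewrite eqn_leq; apply/andP; split.
  have [x [p [walkp /eqP sizep <-]]] := cost_attained x0 linkN v.
  rewrite size_tuple in sizep.
  rewrite -(hamming_mismatches v (Tuple sizep)); apply: bigminn_leq.
  apply/imsetP; exists (Tuple sizep) => //; rewrite inE; apply/is_walkP.
  by rewrite (eqP sizep); split=> //; exists x.
apply: bigminn_geP => [|w /imsetP [p]].
  by rewrite (leq_trans (cost_leq_size v)) // size_tuple.
rewrite inE => /is_walkP [_ [x walkp]] ->; rewrite hamming_mismatches.
by apply: (cost_leq walkp); rewrite !size_tuple.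
Qed.

End Codes.

(** * Decoding of edges, words and walks *)

Lemma nth_flatten_triples (T : Type) (f g h : T -> nat) x0 s j : j < size s ->
  [/\ nth 0 (flatten [seq [:: f x; g x;
    h x] | x <- s]) (3 * j) = f (nth x0 s j),
      nth 0 (flatten [seq [:: f x; g x;
        h x] | x <- s]) (3 * j).+1 = g (nth x0 s j) &
      nth 0 (flatten [seq [:: f x; g x;
        h x] | x <- s]) (3 * j).+2 = h (nth x0 s j)].
Proof.
by elim: s j => //= x s IHs [|j] ltj //; rewrite mulnS !addSn add0n;
  exact: (IHs j ltj).
Qed.

Definition decode (F : finType) (z : F) (k n : nat) : seq F :=
  mkseq (fun i => nth z (enum F) (digit #|F| k i)) n.

Lemma size_decode (F : finType) (z : F) k n : size (decode z k n) = n.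
Proof. exact: size_mkseq. Qed.

Lemma ltn_digit (F : finType) (z : F) k i : digit #|F| k i < #|F|.
Proof. by rewrite ltn_mod; apply/card_gt0P; exists z. Qed.

Lemma rank_nth_decode (F : finType) (z z' : F) k n i : i < n ->
  enum_rank (nth z' (decode z k n) i) = digit #|F| k i :> nat.
Proof.
move=> lti; rewrite nth_mkseq //.
rewrite -[digit _ _ _]/(nat_of_ord (Ordinal (ltn_digit z k i))).
by rewrite -enum_val_nth enum_valK.
Qed.

Lemma decode_surj (F : finType) (z : F) s :
  exists2 k, k < #|F| ^ size s & decode z k (size s) = s.
Proof.
have Fgt0 : 0 < #|F| by apply/card_gt0P; exists z.
elim: s => [|x s [k ltk IHs]]; first by exists 0.
(* The first letter is the least significant digit. *)
exists (enum_rank x + k * #|F|).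
  rewrite /= expnSr; apply: (@leq_trans (k.+1 * #|F|)).
    by rewrite mulSn -addSn leq_add2r ltn_ord.
  by rewrite leq_pmul2r.
rewrite /decode /mkseq /= -add1n iotaDl -map_comp; congr (_ :: _).
  rewrite /digit expn0 divn1 addnC modnMDl modn_small ?ltn_ord //.
  by rewrite nth_enum_rank.
rewrite -[RHS]IHs; apply: eq_map => i /=; congr nth.
by rewrite /digit add1n expnS divnMA addnC divnMDl // (divn_small (ltn_ord _))
  addn0.
Qed.

Lemma sum_eq0P k (f : nat -> nat) :
  \sum_(0 <= i < k) f i = 0 <-> forall i, i < k -> f i = 0.
Proof.
rewrite big_mkord; split=> [/eqP|f0].
  by rewrite sum_nat_eq0 => /forallP f0 i lti; apply/eqP/(f0 (Ordinal lti)).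
by rewrite big1 // => i _; exact: f0.
Qed.

Lemma minf1_eq0P k (f : nat -> nat) :
  minf 1 k f = 0 <-> exists2 i, i < k & f i = 0.
Proof.
split=> [|[i lti fi0]]; last by apply/eqP; rewrite -leqn0 -fi0 minf_leq.
apply: contra_eqP; rewrite -lt0n => nex; apply: minf_geP => // i lti.
by rewrite lt0n; apply/negP => /eqP fi0; apply: nex; exists i.
Qed.

Section Description.

Variables (G : labeled_graph) (e0 : edge G).
Let c := CodeSeq.code (description G).
Local Notation E := #|edge G|.
Local Notation follows := (fun e e' : edge G => tgt e == src e').

Lemma nthc_alphabet : nthc c 0 = #|alphabet G|.
Proof. exact: nthc_code. Qed.

Lemma nthc_vertex : nthc c 1 = #|vertex G|.
Proof. exact: nthc_code. Qed.

Lemma edgesc_description : edgesc c = E.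
Proof.
rewrite /edgesc sizec_code /= subn2 /=.
rewrite (_ : size _ = 3 * size (enum (edge G))) ?mulKn //.
  by rewrite -cardE.
by elim: (enum _) => //= e s ->; rewrite mulnS.
Qed.

Lemma edge_description p n i : i < n ->
  let e := nth e0 (decode e0 p n) i in
  [/\ srcc c (edgec c p i) = enum_rank (src e),
      tgtc c (edgec c p i) = enum_rank (tgt e) &
      labelc c (edgec c p i) = enum_rank (label e)].
Proof.
move=> lti /=; rewrite nth_mkseq // /edgec edgesc_description.
rewrite /srcc /tgtc /labelc !nthc_code /description /=.
apply: nth_flatten_triples; rewrite -cardE; exact: ltn_digit e0 _ _.
Qed.

Lemma breaksc_eq0 p n : (breaksc c n p == 0) = sorted follows (decode e0 p n).
Proof.
apply/eqP/(sortedP e0); rewrite size_decode.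
  move/sum_eq0P => brk i ltin; have /brk : i < n - 1 by lia.
  have [_ -> _] := edge_description p (ltnW ltin).
  have [-> _ _] := edge_description p ltin.
  by case: eqP => // /val_inj /enum_rank_inj /eqP.
move=> srt; apply/sum_eq0P => i lti; have ltin : i.+1 < n by lia.
have [_ -> _] := edge_description p (ltnW ltin).
have [-> _ _] := edge_description p ltin.
by rewrite (eqP (srt _ ltin)) eqxx.
Qed.

Lemma mismatchesc_description a0 p v n :
  mismatchesc c n p v = mismatches (decode e0 p n) (decode a0 v n).
Proof.
rewrite (mismatches_sum e0 a0 (n := n)) ?size_decode //.
apply: eq_big_nat => i /andP [_ lti].
have [_ _ ->] := edge_description p lti.
rewrite nthc_alphabet -(rank_nth_decode a0 a0 v lti).
by rewrite (inj_eq val_inj) (inj_eq enum_rank_inj).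
Qed.

Lemma sorted_walk p : sorted follows p <-> exists x, walk_from x p.
Proof.
case: p => [|e p]; first by split=> // _; exists (src e0).
by rewrite -[sorted _ _]/(is_walk (e :: p)); split=> [/is_walkP []|H] //;
  apply/is_walkP.
Qed.

(** For maxima and minima it is enough that the codes reach all words and all edge sequences, whence
    [decode_surj]. *)
Lemma radiusc_description N n : connects G N.+1 ->
  radiusc c n = \max_(v : n.-tuple (alphabet G)) cost v.
Proof.
move=> linkN; rewrite /radiusc nthc_alphabet edgesc_description.
set a0 := label e0.
have costE v : minf n (E ^ n) (fun p =>
    ifz (breaksc c n p) (mismatchesc c n p v) n) = cost (decode a0 v n).
  apply/eqP; rewrite eqn_leq; apply/andP; split.
    have [x [p [walkp sizep <-]]] := cost_attained (src e0) linkN (decode a0 v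
      n).
    have [k ltk eqp] := decode_surj e0 p.
    rewrite size_decode in sizep; rewrite sizep in ltk eqp.
    apply: leq_trans (minf_leq _ _ ltk) _.
    rewrite /ifz breaksc_eq0 eqp ifT; last by apply/sorted_walk; exists x.
    by rewrite (mismatchesc_description a0) eqp.
  apply: minf_geP => [|p _].
    by rewrite (leq_trans (cost_leq_size _)) // size_decode.
  rewrite /ifz breaksc_eq0; case: ifP => [/sorted_walk [x walkp]|_].
    rewrite (mismatchesc_description a0); apply: (cost_leq walkp).
    by rewrite !size_decode.
  by rewrite (leq_trans (cost_leq_size _)) // size_decode.
apply/eqP; rewrite eqn_leq; apply/andP; split.
  apply: maxf_leP => v _; rewrite costE.
  have /eqP sz := size_decode a0 v n.
  exact: (leq_bigmax (F := fun v : n.-tuple _ => cost v) (Tuple sz)).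
apply/bigmax_leqP => v _; have [k ltk eqv] := decode_surj a0 v.
rewrite size_tuple in ltk eqv; apply: leq_trans (leq_maxf _ ltk).
by rewrite costE eqv.
Qed.

Lemma unlinkedc_eq0 n : unlinkedc c n.+1 = 0 <-> connects G n.+1.
Proof.
have rank0 (x : vertex G) u : nat_of_bool (enum_rank x != u :> nat) = 0 ->
  enum_rank x = u :> nat.
  by case: eqP.
rewrite /unlinkedc nthc_vertex edgesc_description; split=> [un0 x y|linkn].
  have := un0; move/sum_eq0P/(_ _ (ltn_ord (enum_rank x))).
  move/sum_eq0P/(_ _ (ltn_ord (enum_rank y)))/minf1_eq0P => [p _ /eqP].
  rewrite !addn_eq0 breaksc_eq0 subSS subn0 => /andP [/andP [srt]].
  have [-> _ _] := edge_description p (ltn0Sn n).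
  have [_ -> _] := edge_description p (ltnSn n).
  move=> /eqP/rank0/val_inj/enum_rank_inj srcx /eqP/rank0/val_inj/enum_rank_inj
    tgty.
  have sz := size_decode e0 p n.+1.
  exists (decode e0 p n.+1); split=> //.
    move: srt srcx sz; case: (decode e0 p n.+1) => [|e q] //= srt <- _.
    by rewrite -/(walk_from (src e) (e :: q)) -is_walk_cons.
  move: tgty sz; rewrite -[n in nth _ _ n]/n.+1.-1.
  case: (decode e0 p n.+1) => [|e q] //= <- [<-].
  by rewrite walk_end_cons (last_nth e0).
apply/sum_eq0P => u ltu; apply/sum_eq0P => w ltw; apply/minf1_eq0P.
have [q [walkq sizeq endq]] := linkn (enum_val (Ordinal ltu)) (enum_val
  (Ordinal ltw)).
have [p ltp eqq] := decode_surj e0 q; rewrite sizeq in ltp eqq.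
exists p => //; apply/eqP; rewrite !addn_eq0 breaksc_eq0 eqq subSS subn0.
have [-> _ _] := edge_description p (ltn0Sn n).
have [_ -> _] := edge_description p (ltnSn n).
rewrite eqq; move: walkq sizeq endq;
  case: q {eqq} => //= e q /andP [/eqP srce walkq] [<-].
rewrite walk_end_cons (last_nth e0) => ->; rewrite srce !enum_valK !eqxx !andbT.
by have : walk_from (src e) (e :: q); [rewrite /= eqxx | rewrite -is_walk_cons].
Qed.

End Description.

(** * The covering radius *)

Section Limit.

Import Order.TTheory GRing.Theory Num.Theory.
Import numFieldNormedType.Exports.
Local Open Scope ring_scope.
Local Open Scope classical_set_scope.

(** The two bounds say that q c(n) and a n differ by at most q b, so the ratio is within b / n of a
    / q. *)
Lemma cvg_ratio (R : realType) (c : nat -> nat) (a q b : nat) : (0 < q)%N ->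
  (forall n, q * c n.+1 <= a * n.+1 + q * b)%N ->
  (forall n, a * n.+1 <= q * (c n.+1 + b))%N ->
  (fun n => (c n)%:R / n%:R : R) @ \oo --> (a%:R / q%:R : R).
Proof.
move=> q0 ub lb; apply/cvgrPdist_lt => eps eps0; near=> n.
have n0 : 0 < n%:R :> R by near: n; exact: nbhs_infty_gtr.
have qR0 : 0 < q%:R :> R by rewrite ltr0n.
have lt_bn : b%:R / eps < n%:R by near: n; exact: nbhs_infty_gtr.
rewrite ltr0n in n0 *; rewrite -mulNr addf_div ?pnatr_eq0 -?lt0n //.
rewrite -!natrM mulNr -natrM normrM normfV normr_nat ltr_pdivrMr ?ltr0n
  ?muln_gt0 ?q0 //.
apply: (@le_lt_trans _ _ (q * b)%:R).
  rewrite ler_norml; have := ub n.-1; have := lb n.-1; rewrite prednK //.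
  rewrite mulnDr -!(ler_nat R) !natrD [(c n * q)%N]mulnC; lra.
by rewrite !natrM mulrCA ltr_pM2l // mulrC -ltr_pdivrMr.
Unshelve. all: by end_near. Qed.

End Limit.

Lemma round_ratio q r a K B : 0 < q ->
  q * r <= a * (q * (K + B + 1)) + q * K ->
    a * (q * (K + B + 1)) <= q * (r + B) ->
  (r + B) %/ (K + B + 1) = a.
Proof.
move=> qgt0; rewrite mulnCA -mulnDr !leq_pmul2l // => ub lb.
apply/eqP; rewrite eqn_leq; apply/andP; split;
  last by rewrite leq_divRL // addn1.
rewrite -ltnS ltn_divLR ?addn1 // mulSn; move: ub; rewrite addn1; lia.
Qed.

Theorem theoremB :
  exists M : recfun 1,
    forall G : labeled_graph, primitive G ->
      exists p q : nat,
        [/\ outputs_fraction M G p q, (0 < q)%N &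
            forall R : realType,
              is_covering_radius (sofic_shift G) (p%:R / q%:R : R)%R].
Proof.
have [M HM] := covering_radius_program; exists M => G primG.
have [irrG [_ gcdG]] := primG.
have [e0 _] : exists e : edge G, True.
  (* Without edges there are no cycles, and 0 would divide all their lengths. *)
  apply: contrapT => noedge; suff : 0 %| 1 by [].
  by apply: gcdG => l [e _]; case: noedge; exists e.
pose c := CodeSeq.code (description G).
have [n0 link0] := primitive_connects primG.
have [|N [/unlinkedc_eq0 linkN runM]] := HM c.
  by exists n0; apply/unlinkedc_eq0.
have {}linkN := linkN e0.
have [a] := cost_growth (src e0) linkN.
set K := 2 ^ _ => -[ub lb].
pose B := K + K ^ 2; pose rho n := \max_(v : n.-tuple (alphabet G)) cost v.
have rho_ub n : K`! * rho n <= a * n + K`! * K.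
  rewrite mulnC -leq_divRL ?fact_gt0 //; apply/bigmax_leqP => v _.
  by rewrite leq_divRL ?fact_gt0 // mulnC -{2}(size_tuple v).
have rho_lb n : a * n <= K`! * (rho n + B).
  have [v /eqP sizev /leq_trans -> //] := lb n.
  rewrite leq_mul2l leq_add2r; apply/orP; right.
  exact: (leq_bigmax (F := fun v : n.-tuple _ => cost v) (Tuple sizev)).
have Kgt0 := fact_gt0 K.
exists a, K`!; split=> // [|R].
  rewrite /outputs_fraction; move: runM; congr computes.
  have stateE : statesc c N.+1 = K by rewrite /statesc nthc_vertex.
  rewrite /outc /numerc /slackc stateE (radiusc_description e0 _ linkN).
  rewrite (@round_ratio K`! _ a) /= ?double0 ?muln1 ?mul2n //; exact: rho_ub.
(* The upper bound has error K, at most B, so one constant serves both sides. *)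
apply: (cvg_ratio Kgt0 (b := B)) => n;
  rewrite (sofic_covering_radius _ (src e0) irrG linkN).
  apply: leq_trans (rho_ub _) _; rewrite leq_add2l leq_mul2l; apply/orP; right.
  exact: leq_addr.
exact: rho_lb.
Qed.
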